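(* Let $w$ be a weight function on $[0,1]$ and $\phi w(x)=(1-x)^2w(x)$. If $f\in L^2(\Omega,w)$, then for $n\ge1$ $$\|f-S_n f\|_{L^2(\Omega,w)}^2=2\left(\|s_n(w;f_e)-f_e\|_{L^2(w)}^2+\|s_{n-1}(\phi w;f_o)-f_o\|_{L^2(\phi w)}^2\right),$$ where $f_e(x)=\tfrac12(f(x,1)+f(1,x))$ and $f_o(x)=\tfrac12\frac{f(x,1)-f(1,x)}{1-x}$.
   Context: $\Omega=\{(x_1,1):x_1\in[0,1]\}\cup\{(1,x_2):x_2\in[0,1]\}$. A weight function on $[0,1]$ is a nonnegative measurable function with all moments finite and with positive integral. For a weight $v$ on $[0,1]$, $\|g\|_{L^2(v)}^2=\int_0^1|g|^2v\,dx$, $p_n(v;\cdot)$ is an orthogonal polynomial of degree exactly $n$ with respect to $v$, $h_n(v)=\int_0^1|p_n(v;x)|^2v(x)\,dx$, and for $g\in L^2(v)$ $$s_n(v;g)(x)=\sum_{k=0}^n\widehat g_k(v)\,p_k(v;x),\qquad \widehat g_k(v)=\frac1{h_k(v)}\int_0^1 g(y)p_k(v;y)v(y)\,dy.$$ Define $\langle f,g\rangle_w=\int_0^1 f(x,1)g(x,1)w(x)\,dx+\int_0^1 f(1,y)g(1,y)w(y)\,dy$; $L^2(\Omega,w)$ is the space of measurable functions on $\Omega$ with $\|f\|_{L^2(\Omega,w)}:=\langle f,f\rangle_w^{1/2}<\infty$. (For $f\in L^2(\Omega,w)$ one has $f_e\in L^2(w)$, $f_o\in L^2(\phi w)$.)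 Put $$P_n(x,y)=p_n(w;x)+p_n(w;y)-p_n(w;1),\qquad Q_n(x,y)=(1-x)p_{n-1}(\phi w;x)-(1-y)p_{n-1}(\phi w;y)\quad(n\ge1),$$ which together with the constant $1$ are mutually orthogonal, and $$S_nf=\frac{\langle f,1\rangle_w}{\langle1,1\rangle_w}+\sum_{k=1}^n\left[\frac{\langle f,P_k\rangle_w}{\langle P_k,P_k\rangle_w}P_k+\frac{\langle f,Q_k\rangle_w}{\langle Q_k,Q_k\rangle_w}Q_k\right].$$ *)

(* Defs.v *)
From HB Require Import structures.
From mathcomp Require Import all_boot all_order all_algebra.
From mathcomp Require Import all_classical all_reals all_analysis.

Set Implicit Arguments.
Unset Strict Implicit.
Unset Printing Implicit Defensive.

Import Order.TTheory GRing.Theory Num.Theory.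
Import numFieldNormedType.Exports.

Local Open Scope classical_set_scope.
Local Open Scope ring_scope.

(* Functions on [0,1] are functions R -> R, and functions on Omega are
   functions R * R -> R; their values elsewhere are never used.  Measurability
   is Borel measurability. *)

Definition I01 {R : realType} : set R := `[0, 1].

Section UnitInterval.
Variable R : realType.
Local Notation mu := (@lebesgue_measure R).

Record is_weight (v : R -> R) : Prop := IsWeight {
  weight_ge0 : forall x : R, 0 <= x <= 1 -> 0 <= v x;
  weight_measurable : measurable_fun I01 v;
  weight_moments : forall n : nat,
    mu.-integrable I01 (fun x => (x ^+ n * v x)%:E);
  weight_integral_gt0 : (0 < \int[mu]_(x in I01) (v x)%:E)%E
}.

(* Extended-real valued, so that it is +oo outside of L^2(v). *)
Definition normL2 (v g : R -> R) : \bar R :=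
  ((\int[mu]_(x in I01) (`|g x| ^+ 2 * v x)%:E) `^ (2^-1))%E.

(* No normalization of the p n is imposed. *)
Definition is_orthopoly (v : R -> R) (p : nat -> {poly R}) : Prop :=
  (forall n, size (p n) = n.+1) /\
  (forall m n, m != n ->
    \int[mu]_(x in I01) ((p m).[x] * (p n).[x] * v x) = 0).

Definition sqnorm_poly (v : R -> R) (p : nat -> {poly R}) (n : nat) : R :=
  \int[mu]_(x in I01) (`|(p n).[x]| ^+ 2 * v x).

Definition fourier_coef (v : R -> R) (p : nat -> {poly R}) (g : R -> R)
    (k : nat) : R :=
  (sqnorm_poly v p k)^-1 * \int[mu]_(y in I01) (g y * (p k).[y] * v y).

Definition partial_sum (v : R -> R) (p : nat -> {poly R}) (n : nat)
    (g : R -> R) : R -> R :=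
  fun x => \sum_(0 <= k < n.+1) fourier_coef v p g k * (p k).[x].

Definition phi (x : R) : R := (1 - x) ^+ 2.

End UnitInterval.

Section Wedge.
Variable R : realType.
Local Notation mu := (@lebesgue_measure R).

Definition Omega : set (R * R) :=
  [set z | (0 <= z.1 <= 1 /\ z.2 = 1) \/ (z.1 = 1 /\ 0 <= z.2 <= 1)].

Definition edotOmega (w : R -> R) (f g : R * R -> R) : \bar R :=
  (\int[mu]_(x in I01) (f (x, 1%R) * g (x, 1%R) * w x)%:E +
   \int[mu]_(y in I01) (f (1%R, y) * g (1%R, y) * w y)%:E)%E.

(* The real-valued inner product; edotOmega w f g is finite whenever
   f and g are in L^2(Omega, w). *)
Definition dotOmega (w : R -> R) (f g : R * R -> R) : R :=
  fine (edotOmega w f g).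

Definition normOmega (w : R -> R) (f : R * R -> R) : \bar R :=
  ((edotOmega w f f) `^ (2^-1))%E.

Definition in_L2Omega (w : R -> R) (f : R * R -> R) : Prop :=
  measurable_fun Omega f /\ (normOmega w f < +oo)%E.

(* p is meant to be orthogonal for w, and q for phi * w. *)
Definition polyP (p : nat -> {poly R}) (n : nat) : R * R -> R :=
  fun z => (p n).[z.1] + (p n).[z.2] - (p n).[1].

(* Only used for n >= 1. *)
Definition polyQ (q : nat -> {poly R}) (n : nat) : R * R -> R :=
  fun z => (1 - z.1) * (q n.-1).[z.1] - (1 - z.2) * (q n.-1).[z.2].

Definition partial_sumOmega (w : R -> R) (p q : nat -> {poly R}) (n : nat)
    (f : R * R -> R) : R * R -> R :=
  fun z => dotOmega w f (cst 1) / dotOmega w (cst 1) (cst 1) +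
    \sum_(1 <= k < n.+1)
      (dotOmega w f (polyP p k) / dotOmega w (polyP p k) (polyP p k)
         * polyP p k z +
       dotOmega w f (polyQ q k) / dotOmega w (polyQ q k) (polyQ q k)
         * polyQ q k z).

Definition f_even (f : R * R -> R) : R -> R :=
  fun x => 2^-1 * (f (x, 1) + f (1, x)).

(* At the single point x = 1 the value is 0, since division by 0 gives 0. *)
Definition f_odd (f : R * R -> R) : R -> R :=
  fun x => 2^-1 * ((f (x, 1) - f (1, x)) / (1 - x)).

End Wedge.

(* Main.v *)
Require Import Defs.
From HB Require Import structures.
From mathcomp Require Import all_boot all_order all_algebra.
From mathcomp Require Import all_classical all_reals all_analysis.
From mathcomp Require Import measurable_realfun ring lra.
Import Order.TTheory GRing.Theory Num.Theory.
Import numFieldNormedType.Exports.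
Local Open Scope classical_set_scope.
Local Open Scope ring_scope.

(** The reflection (x, y) -> (y, x) exchanges the two edges of the wedge, so f
is described by its even part f_even and its odd part (1 - x) * f_odd: the two
edge traces of f are f_even + (1 - x) * f_odd and f_even - (1 - x) * f_odd.
The basis respects this splitting: 1 and P_k are even, with trace 1 and p_k,
while Q_k is odd, with trace (1 - x) * q_(k-1).

For g with traces r and s * r, where s = 1 or s = -1, the two edges contribute
equally, so the factors 2 in <f, g> and <g, g> cancel and the quotient becomes
a one-variable Fourier coefficient [fourier_coef_edges].  For P_k it is the
coefficient of f_even for w; for Q_k one factor 1 - x comes from the trace and
one from the odd part of f, so it is the coefficient of f_odd for phi * w.
Hence S_n f has traces A + (1 - x) * B and A - (1 - x) * B, where A and B are
the partial sums of f_even and f_odd [partial_sumOmega_edges].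

The traces of f - S_n f are then E + D and E - D with E = f_even - A and
D = (1 - x) * (f_odd - B), and the parallelogram law integrated against w
[parallelogram_weight] gives the claim, because D^2 w is
(f_odd - B)^2 (phi * w).

All basis functions have polynomial traces; integrability of their products
with f, which lets <f, g> be split into two real integrals, comes from
|a b| <= a^2 + b^2 and the finiteness of the moments of w. *)

Section WeightedL2.
Set Implicit Arguments.
Unset Strict Implicit.
Unset Printing Implicit Defensive.
Variable R : realType.
Local Notation mu := (@lebesgue_measure R).
Implicit Types (w F G : R -> R) (r : {poly R}).

(** Measurability is part of the definition because the integrability of
F^2 w carries no information on F where w vanishes. *)
Definition square_integrable w F : Prop :=
  measurable_fun (@I01 R) F /\
  mu.-integrable I01 (fun x => (F x * F x * w x)%:E).

Lemma measurable_I01 : measurable (@I01 R).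
Proof. exact: measurable_itv. Qed.
Hint Resolve measurable_I01 : core.

Lemma I01P (x : R) : I01 x -> 0 <= x <= 1.
Proof. by rewrite /I01 /= in_itv. Qed.

Lemma sqr_weight_ge0 w F x : is_weight w -> I01 x -> 0 <= F x * F x * w x.
Proof.
by move=> ww /I01P/(weight_ge0 ww) wx; rewrite mulr_ge0// -expr2 sqr_ge0.
Qed.

Lemma measurable_horner (D : set R) r : measurable_fun D (horner r).
Proof.
apply: measurable_funTS; apply: continuous_measurable_fun.
exact: continuous_horner.
Qed.

Lemma integrable_horner_weight w r : is_weight w ->
  mu.-integrable I01 (fun x => (r.[x] * w x)%:E).
Proof.
move=> ww; have iS : mu.-integrable I01
    (fun x => \sum_(i < size r) (r`_i * (x ^+ i * w x))%:E).
  apply: integrable_sum => // i _.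
  under eq_fun do rewrite EFinM.
  by apply: integrableZl => //; exact: weight_moments.
apply: (eq_integrable _ _ _ _ iS) => // x _.
by rewrite sumEFin horner_coef mulr_suml; under eq_bigr do rewrite mulrA.
Qed.

Lemma square_integrable_horner w r : is_weight w ->
  square_integrable w (horner r).
Proof.
move=> ww; split; first exact: measurable_horner.
under eq_fun do rewrite -hornerM.
exact: integrable_horner_weight.
Qed.

Lemma measurable_prod_weight w F G : is_weight w ->
  measurable_fun I01 F -> measurable_fun I01 G ->
  measurable_fun I01 (fun x => (F x * G x * w x)%:E).
Proof.
move=> ww mF mG; apply/measurable_EFinP.
apply: measurable_funM; first exact: measurable_funM.
exact: weight_measurable.
Qed.

(** Cauchy-Schwarz is replaced by the pointwise bound
|F G w| <= F^2 w + G^2 w. *)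
Lemma integrable_prod_weight w F G : is_weight w ->
  square_integrable w F -> square_integrable w G ->
  mu.-integrable I01 (fun x => (F x * G x * w x)%:E).
Proof.
move=> ww [mF iF] [mG iG].
have iD := @integrableD _ _ _ mu _ measurable_I01 _ _ iF iG.
apply: (@le_integrable _ _ _ mu _ measurable_I01 _ _ _ _ iD).
  exact: measurable_prod_weight.
move=> x /I01P/(weight_ge0 ww) wx /=.
rewrite lee_fin -mulrDl !normrM ler_wpM2r// -normrM ler_norml.
rewrite (ger0_norm (_ : 0 <= F x * F x + G x * G x)); last nra.
apply/andP; split; nra.
Qed.

(** Everything is nonnegative, so the identity holds in the extended reals,
without any square integrability. *)
Lemma parallelogram_weight w F G : is_weight w ->
  measurable_fun I01 F -> measurable_fun I01 G ->
  (\int[mu]_(x in I01) ((F x + G x) * (F x + G x) * w x)%:E +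
   \int[mu]_(x in I01) ((F x - G x) * (F x - G x) * w x)%:E =
   2%:E * (\int[mu]_(x in I01) (F x * F x * w x)%:E +
           \int[mu]_(x in I01) (G x * G x * w x)%:E))%E.
Proof.
move=> ww mF mG.
have sq_ge0 (H : R -> R) x : I01 x -> (0 <= (H x * H x * w x)%:E)%E.
  by move=> Ix; rewrite lee_fin sqr_weight_ge0.
have mD : measurable_fun I01 (F \+ G) by exact: measurable_funD.
have mB : measurable_fun I01 (F \- G) by exact: measurable_funB.
rewrite -(@ge0_integralD _ _ _ mu _ measurable_I01); first last.
- exact: (measurable_prod_weight ww mB mB).
- exact: (sq_ge0 (F \- G)).
- exact: (measurable_prod_weight ww mD mD).
- exact: (sq_ge0 (F \+ G)).
rewrite -(@ge0_integralD _ _ _ mu _ measurable_I01); first last.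
- exact: (measurable_prod_weight ww mG mG).
- exact: sq_ge0.
- exact: (measurable_prod_weight ww mF mF).
- exact: sq_ge0.
rewrite -ge0_integralZl_EFin//; first last.
- apply: emeasurable_funD.
    exact: (measurable_prod_weight ww mF mF).
  exact: (measurable_prod_weight ww mG mG).
- by move=> x Ix; rewrite adde_ge0// sq_ge0.
apply: eq_integral => x _.
rewrite -!EFinD -EFinM; congr EFin; ring.
Qed.

Lemma edotOmega_ge0 w (f : R * R -> R) : is_weight w ->
  (0 <= edotOmega w f f)%E.
Proof.
move=> ww; apply: adde_ge0; apply: integral_ge0 => x Ix; rewrite lee_fin.
  exact: (sqr_weight_ge0 (fun y => f (y, 1)) ww Ix).
exact: (sqr_weight_ge0 (fun y => f (1, y)) ww Ix).
Qed.

Lemma normOmega_sqr w f : is_weight w ->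
  (normOmega w f ^+ 2 = edotOmega w f f)%E.
Proof.
by move=> ww; rewrite /normOmega poweR12_sqrt ?sqr_sqrte// edotOmega_ge0.
Qed.

Lemma normL2_sqr (v g : R -> R) : (forall x, 0 <= x <= 1 -> 0 <= v x) ->
  (normL2 v g ^+ 2 = \int[mu]_(x in I01) (`|g x| ^+ 2 * v x)%:E)%E.
Proof.
move=> v0; have i0 : (0 <= \int[mu]_(x in I01) (`|g x| ^+ 2 * v x)%:E)%E.
  apply: integral_ge0 => x /I01P/v0 vx.
  by rewrite lee_fin mulr_ge0// exprn_ge0.
by rewrite /normL2 poweR12_sqrt// sqr_sqrte.
Qed.

Lemma measurable_Omega : measurable (@Omega R).
Proof.
have -> : @Omega R = (I01 `*` [set 1]) `|` ([set 1] `*` I01).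
  by apply/seteqP; split => -[x y]; rewrite /Omega /I01 /= !in_itv.
by apply: measurableU; apply: measurableX => //; exact: measurable_set1.
Qed.

Lemma square_integrable_edges w f : is_weight w -> in_L2Omega w f ->
  square_integrable w (fun x => f (x, 1)) /\
  square_integrable w (fun x => f (1, x)).
Proof.
move=> ww [mf].
have two_neq0 : (2^-1 : R) != 0 by rewrite invr_eq0 pnatr_eq0.
move=> /(lty_poweRy two_neq0); rewrite /edotOmega => fin.
have sq_ge0 (H : R -> R) x : I01 x -> (0 <= (H x * H x * w x)%:E)%E.
  by move=> Ix; rewrite lee_fin sqr_weight_ge0.
have int_ge0 (H : R -> R) : (0 <= \int[mu]_(x in I01) (H x * H x * w x)%:E)%E.
  by apply: integral_ge0 => x; exact: sq_ge0.
have sqi (H : R -> R) : measurable_fun I01 H ->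
    (\int[mu]_(x in I01) (H x * H x * w x)%:E < +oo)%E ->
    square_integrable w H.
  move=> mH Hfin; split => //; apply/integrableP; split.
    exact: (measurable_prod_weight ww mH mH).
  rewrite (@eq_integral _ _ _ mu _ (fun x => (H x * H x * w x)%:E))//.
    move=> x /set_mem Ix.
  by rewrite gee0_abs// sq_ge0.
have mOmega := measurable_Omega.
split; apply: sqi.
- apply: (measurable_comp (F := @Omega R) (g := fun x => (x, 1))) => //.
    by move=> _ [x /I01P Ix <-]; left.
  exact/measurable_funTS/pair2_measurable.
- apply: le_lt_trans fin; apply: leeDl; exact: (int_ge0 (fun y => f (1, y))).
- apply: (measurable_comp (F := @Omega R) (g := fun x => (1, x))) => //.
    by move=> _ [x /I01P Ix <-]; right.
  exact/measurable_funTS/pair1_measurable.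
- apply: le_lt_trans fin; apply: leeDr; exact: (int_ge0 (fun x => f (x, 1))).
Qed.

(** The sign s is the parity of g under the exchange of the two edges, so
s * s = 1; both edges contribute equally to <g, g>, and f enters <f, g> only
through its part of parity s.  If r vanishes almost everywhere for w, both
sides are 0 by the convention on inverses. *)
Lemma fourier_coef_edges w f g r s : is_weight w -> in_L2Omega w f ->
  s * s = 1 ->
  (forall x, g (x, 1) = r.[x]) -> (forall x, g (1, x) = s * r.[x]) ->
  dotOmega w f g / dotOmega w g g =
  (\int[mu]_(x in I01) (`|r.[x]| ^+ 2 * w x))^-1 *
  \int[mu]_(x in I01) (2^-1 * (f (x, 1) + s * f (1, x)) * r.[x] * w x).
Proof.
move=> ww fL2 ss g1 g2; have [F2 G2] := square_integrable_edges ww fL2.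
have r2 := square_integrable_horner r ww.
have iF := integrable_prod_weight ww F2 r2.
have iG := integrable_prod_weight ww G2 r2.
have irr := integrable_prod_weight ww r2 r2.
have -> : dotOmega w g g = 2 * \int[mu]_(x in I01) (`|r.[x]| ^+ 2 * w x).
  rewrite /dotOmega /edotOmega.
  under eq_integral do rewrite g1.
  under [X in (_ + X)%E]eq_integral do
    rewrite g2 mulrACA ss mul1r.
  rewrite fineD ?integrable_fin_num// mulr_natl mulr2n.
  by congr (_ + _); apply: eq_Rintegral => x _; rewrite real_normK ?num_real.
have -> : dotOmega w f g = 2 * \int[mu]_(x in I01)
    (2^-1 * (f (x, 1) + s * f (1, x)) * r.[x] * w x).
  rewrite /dotOmega /edotOmega.
  under eq_integral do rewrite g1.
  under [X in (_ + X)%E]eq_integral do rewrite g2 mulrCA -mulrA.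
  have isG : mu.-integrable I01 (fun x => (s * (f (1, x) * r.[x] * w x))%:E).
    by under eq_fun do rewrite EFinM; exact: integrableZl.
  rewrite fineD ?integrable_fin_num//.
  rewrite -[LHS]RintegralD// -RintegralZl//; first last.
    have iFG := @integrableD _ _ _ mu _ measurable_I01 _ _ iF isG.
    have isum := @integrableZl _ _ _ mu _ measurable_I01 2^-1 _ iFG.
    apply: (eq_integrable _ _ _ _ isum) => // x _ /=.
    by rewrite -EFinD -EFinM; congr EFin; ring.
  apply: eq_Rintegral => x _; by field.
by rewrite invfM mulrACA divff ?pnatr_eq0// mul1r mulrC.
Qed.

(** At x = 1 both sides vanish, since (x, 1) and (1, x) are then the same
point. *)
Lemma f_odd_mul (f : R * R -> R) x :
  (1 - x) * f_odd f x = 2^-1 * (f (x, 1) - f (1, x)).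
Proof.
rewrite /f_odd; have [->|x1] := eqVneq x 1.
  by rewrite !subrr !(mul0r, mulr0).
by field; rewrite subr_eq0 eq_sym.
Qed.

Section Expansion.
Variables (w : R -> R) (f : R * R -> R) (p q : nat -> {poly R}).
Hypotheses (ww : is_weight w) (fL2 : in_L2Omega w f).

(** The degree 0 polynomial p 0 is a nonzero constant but not necessarily 1;
its value cancels from the projection onto constants. *)
Lemma coef_constE : size (p 0) = 1%N -> forall x,
  dotOmega w f (cst 1) / dotOmega w (cst 1) (cst 1) =
  fourier_coef w p (f_even f) 0 * (p 0).[x].
Proof.
move=> /eqP/size_poly1P[c c0 pE] x.
rewrite (@fourier_coef_edges w f (cst 1) 1 1)//; first last.
- by move=> y; rewrite hornerC mulr1.
- by move=> y; rewrite hornerC.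
- by rewrite mulr1.
have [F2 G2] := square_integrable_edges ww fL2.
have one2 := square_integrable_horner 1 ww.
have iw := integrable_horner_weight 1 ww.
have iFG := @integrableD _ _ _ mu _ measurable_I01 _ _
  (integrable_prod_weight ww F2 one2) (integrable_prod_weight ww G2 one2).
have ife0 := @integrableZl _ _ _ mu _ measurable_I01 2^-1 _ iFG.
have ife : mu.-integrable I01 (EFin \o (fun y => f_even f y * w y)).
  apply: (eq_integrable _ _ _ _ ife0) => // y _ /=.
  by rewrite -EFinD -EFinM hornerC /f_even; congr EFin; ring.
have iw1 : mu.-integrable I01 (EFin \o w).
  by apply: (eq_integrable _ _ _ _ iw) => // y _ /=; rewrite hornerC mul1r.
have -> : \int[mu]_(y in I01) (`|1.[y]| ^+ 2 * w y) =
          \int[mu]_(y in I01) w y.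
  by apply: eq_Rintegral => y _; rewrite hornerC normr1 expr1n mul1r.
have -> : \int[mu]_(y in I01) (2^-1 * (f (y, 1) + 1 * f (1, y)) * 1.[y] * w y)
        = \int[mu]_(y in I01) (f_even f y * w y).
  by apply: eq_Rintegral => y _; rewrite hornerC mul1r mulr1.
have hE : sqnorm_poly w p 0 = c ^+ 2 * \int[mu]_(y in I01) w y.
  rewrite -RintegralZl//; apply: eq_Rintegral => y _.
  by rewrite pE hornerC real_normK ?num_real.
have gE : \int[mu]_(y in I01) (f_even f y * (p 0).[y] * w y) =
          c * \int[mu]_(y in I01) (f_even f y * w y).
  rewrite -RintegralZl//; apply: eq_Rintegral => y _.
  by rewrite pE hornerC; ring.
rewrite /fourier_coef hE gE pE hornerC invfM.
have cancel_c (V J : R) : V * J = c ^- 2 * V * (c * J) * c by field.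
exact: cancel_c.
Qed.

Lemma coef_PE k :
  dotOmega w f (Defs.polyP p k) / dotOmega w (Defs.polyP p k) (Defs.polyP p k) =
  fourier_coef w p (f_even f) k.
Proof.
rewrite (@fourier_coef_edges w f (Defs.polyP p k) (p k) 1)// ?mulr1//;
  first last.
- by move=> y; rewrite /Defs.polyP /= mul1r addrAC subrr add0r.
- by move=> y; rewrite /Defs.polyP /= addrK.
by congr (_ * _); apply: eq_Rintegral => x _; rewrite mul1r.
Qed.

(** The trace of Q_(k+1) is (1 - x) * q_k: its square against w turns w into
phi * w, and so does its product with the odd part (1 - x) * f_odd. *)
Lemma coef_QE k :
  dotOmega w f (polyQ q k.+1) / dotOmega w (polyQ q k.+1) (polyQ q k.+1) =
  fourier_coef (fun x => phi x * w x) q (f_odd f) k.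
Proof.
have hE y : ((1 - 'X) * q k).[y] = (1 - y) * (q k).[y].
  by rewrite hornerM !hornerE.
rewrite (@fourier_coef_edges w f (polyQ q k.+1) ((1 - 'X) * q k) (-1))//;
  first last.
- by move=> y; rewrite /polyQ hE /= subrr mul0r sub0r mulN1r.
- by move=> y; rewrite /polyQ hE /= subrr mul0r subr0.
- by rewrite mulrNN mulr1.
congr (_^-1 * _); apply: eq_Rintegral => x _; rewrite hE.
  by rewrite !real_normK ?num_real// /phi; ring.
by rewrite mulN1r -f_odd_mul /phi; ring.
Qed.

Lemma partial_sumOmega_edges n x : size (p 0) = 1%N ->
  let A := partial_sum w p n.+1 (f_even f) x in
  let B := (1 - x) * partial_sum (fun x => phi x * w x) q n (f_odd f) x in
  partial_sumOmega w p q n.+1 f (x, 1) = A + B /\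
  partial_sumOmega w p q n.+1 f (1, x) = A - B.
Proof.
move=> p0 A B; have AE : A = dotOmega w f (cst 1) / dotOmega w (cst 1) (cst 1)
    + \sum_(0 <= k < n.+1) fourier_coef w p (f_even f) k.+1 * (p k.+1).[x].
  by rewrite /A /partial_sum big_nat_recl// -coef_constE.
have BE : B = \sum_(0 <= k < n.+1) (fourier_coef (fun x => phi x * w x) q
    (f_odd f) k * ((1 - x) * (q k).[x])).
  by rewrite /B mulr_sumr; apply: eq_bigr => k _; ring.
split; rewrite AE BE /partial_sumOmega big_add1/= -addrA.
  rewrite -big_split; congr (_ + _); apply: eq_bigr => k _.
  rewrite coef_PE coef_QE /Defs.polyP /polyQ/=; ring.
rewrite -sumrN -big_split; congr (_ + _); apply: eq_bigr => k _.
rewrite coef_PE coef_QE /Defs.polyP /polyQ/=; ring.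
Qed.

End Expansion.

(** A partial sum is itself a polynomial, whatever g is. *)
Lemma measurable_partial_sum (v : R -> R) (p : nat -> {poly R}) n g :
  measurable_fun I01 (partial_sum v p n g).
Proof.
rewrite [partial_sum _ _ _ _](_ : _ =
  horner (\sum_(0 <= k < n.+1) fourier_coef v p g k *: p k)).
  exact: measurable_horner.
apply/funext => x; rewrite horner_sum.
by apply: eq_bigr => k _; rewrite hornerZ.
Qed.

End WeightedL2.

Theorem corollary2p5 (R : realType) (w : R -> R) (p q : nat -> {poly R})
  (f : R * R -> R) (n : nat) :
  is_weight w ->
  is_orthopoly w p ->
  is_orthopoly (fun x => phi x * w x) q ->
  in_L2Omega w f ->
  (1 <= n)%N ->
  (normOmega w (fun z => (f z - partial_sumOmega w p q n f z)%R) ^+ 2 =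
   2%:E *
   (normL2 w
      (fun x => (partial_sum w p n (f_even f) x - f_even f x)%R) ^+ 2 +
    normL2 (fun x => phi x * w x)%R
      (fun x => (partial_sum (fun x => phi x * w x)%R q n.-1 (f_odd f) x
                 - f_odd f x)%R) ^+ 2))%E.
Proof.
move=> ww [sp _] _ fL2; case: n => // n _.
have [[mF _] [mG _]] := square_integrable_edges ww fL2.
rewrite normOmega_sqr// !normL2_sqr; first last.
- exact: weight_ge0.
- by move=> x /(weight_ge0 ww) wx; rewrite mulr_ge0// sqr_ge0.
set A := partial_sum _ _ _ _; set B := partial_sum _ _ _ _.
(* The even and odd parts of f - S_n f on the edges. *)
pose E x := f_even f x - A x.
(* The odd part is written without f_odd, to have its measurability without
   dividing by 1 - x. *)
pose D x := 2^-1 * (f (x, 1) - f (1, x)) - (1 - x) * B x.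
have mE : measurable_fun I01 E.
  apply: measurable_funB; last exact: measurable_partial_sum.
  by apply: measurable_funM => //; exact: measurable_funD.
have mD : measurable_fun I01 D.
  apply: measurable_funB; apply: measurable_funM => //.
  - exact: measurable_funB.
  - exact: measurable_funB.
  - exact: measurable_partial_sum.
have edges x := partial_sumOmega_edges q ww fL2 n x (sp 0%N).
have -> : (\int[lebesgue_measure]_(x in I01) (`|A x - f_even f x| ^+ 2 * w x)%:E
    = \int[lebesgue_measure]_(x in I01) (E x * E x * w x)%:E)%E.
  apply: eq_integral => x _; rewrite real_normK ?num_real// /E.
  by congr EFin; ring.
have -> : (\int[lebesgue_measure]_(x in I01)
      (`|B x - f_odd f x| ^+ 2 * (phi x * w x))%:E
    = \int[lebesgue_measure]_(x in I01) (D x * D x * w x)%:E)%E.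
  apply: eq_integral => x _; rewrite real_normK ?num_real// /D -f_odd_mul /phi.
  by congr EFin; ring.
rewrite -(parallelogram_weight ww mE mD) /edotOmega.
congr (_ + _)%E; apply: eq_integral => x _; congr EFin.
  have [-> _] := edges x; rewrite -/A -/B.
  have -> : f (x, 1) - (A x + (1 - x) * B x) = E x + D x.
    by rewrite /E /D /f_even; field.
  by [].
have [_ ->] := edges x; rewrite -/A -/B.
have -> : f (1, x) - (A x - (1 - x) * B x) = E x - D x.
  by rewrite /E /D /f_even; field.
by [].
Qed.
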